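(* The operad $\mathrm{EHKR}$ of Etingof--Henriques--Kamnitzer--Rains skew-symmetric quadratic data is the smallest sub-operad of the operad $3\text{-}\mathrm{HG}$ of $3$-hypergraph skew-symmetric quadratic data.
   Context: Work over $\mathbb Q$. For a vector space $V$ (in degree $0$), $V^{\wedge2}\subset V^{\otimes2}$ is spanned by $x\wedge y=x\otimes y-y\otimes x$. The category $\mathbf{QD}^-$ of skew-symmetric quadratic data has objects $(V,R)$ with $R\subset V^{\wedge2}$ and morphisms the linear maps $f$ with $f^{\otimes2}(R)\subset S$; its symmetric monoidal product is $(V,R)\oplus(W,S)=(V\oplus W,R\oplus[V,W]_-\oplus S)$, with $[V,W]_-=\langle v\otimes w-w\otimes v\mid v\in V,w\in W\rangle$, and unit $(0,0)$. An operad in $(\mathbf{QD}^-,\oplus)$ is a (symmetric, unital, with partial compositions) operad in this symmetric monoidal category, with components in all arities $n\ge0$. Let $V(n)$ be the vector space with basis $t^n_I$ indexed by the $3$-element subsets $I\subset\{1,\dots,n\}$ (so $V(n)=0$ for $n<3$); write $t^n_{ijk}=t^n_{\{i,j,k\}}$. The symmetric group $\mathbb S_n$ acts by permuting the labels. For $1\le p\le n$ let $\pi_p:\{1,\dots,n+m-1\}\to\{1,\dots,n\}$ be the monotone map collapsing $\{p,\dots,p+m-1\}$ to $p$ and mapping the remaining elements bijectively and monotonically onto $\{1,\dots,n\}\setminus\{p\}$. The map $\circ_p:V(n)\oplus V(m)\to V(n+m-1)$ is $t^n_I\mapsto\sum t^{n+m-1}_{I'}$, the sum over all $3$-element subsets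 $I'$ mapped bijectively onto $I$ by $\pi_p$, and $t^m_J\mapsto t^{n+m-1}_{J+p-1}$, where $J+a=\{j+a\mid j\in J\}$. $3\text{-}\mathrm{HG}(n)=(V(n),V(n)^{\wedge2})$. $\mathrm{EHKR}(n)=(V(n),R(n))$, where $R(n)$ is spanned by the $t^n_I\wedge t^n_J$ with $I\cap J=\emptyset$, and the $t^n_{ijk}\wedge(t^n_{lmi}+t^n_{lmj}+t^n_{lmk})$ with $i,j,k,l,m\in\{1,\dots,n\}$ distinct. With the maps $\circ_p$, both are operads in $(\mathbf{QD}^-,\oplus)$. A sub-operad of $3\text{-}\mathrm{HG}$ is a collection of skew-symmetric quadratic data $(V(n),S(n))$, $S(n)\subset V(n)^{\wedge2}$, $n\ge0$, with the same generators $V(n)$, that is stable under the partial composition products $\circ_p$ and the symmetric group actions, i.e. forms an operad in $(\mathbf{QD}^-,\oplus)$ with these structure maps. Sub-operads are ordered by inclusion of the relation spaces $S(n)$ for all $n$. *)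

(* Defs.v *)
From HB Require Import structures.
From mathcomp Require Import all_boot all_order all_algebra all_fingroup zify.

Set Implicit Arguments.
Unset Strict Implicit.
Unset Printing Implicit Defensive.

Import GRing.Theory.
Local Open Scope ring_scope.

(* The tensor square of V, in coordinates: the matrix M stands for
   \sum_(i, j) M i j *: (e_i (x) e_j), where e = vbasis {:V}. *)
Definition tens2 (V : vectType rat) : vectType rat := 'M[rat]_(\dim {:V}).

Definition tens (V : vectType rat) (x y : V) : tens2 V :=
  \matrix_(i, j) (coord (vbasis {:V}) i x * coord (vbasis {:V}) j y).

(* f (x) f, extended linearly from the basis e_i (x) e_j; see tens2_mapE. *)
Definition tens2_map (V W : vectType rat) (f : 'Hom(V, W)) :
    'Hom(tens2 V, tens2 W) :=
  linfun (fun M : tens2 V => \sum_i \sum_j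
    (M : 'M[rat]_(\dim {:V})) i j *:
      tens (f (vbasis {:V})`_i) (f (vbasis {:V})`_j)).

Definition wedge (V : vectType rat) (x y : V) : tens2 V := tens x y - tens y x.

(* The span of all x /\ y; by bilinearity (lemma mem_wedge2) it is enough to
   take x and y in a basis of V. *)
Definition wedge2 (V : vectType rat) : {vspace tens2 V} :=
  <<[seq wedge x y | x <- vbasis {:V}, y <- vbasis {:V}]>>%VS.

Lemma tensDl (V : vectType rat) (a : rat) (x y z : V) :
  tens (a *: x + y) z = a *: tens x z + tens y z.
Proof. by apply/matrixP=> i j; rewrite !mxE linearP mulrDl mulrA. Qed.

Lemma tensDr (V : vectType rat) (a : rat) (x y z : V) :
  tens z (a *: x + y) = a *: tens z x + tens z y.
Proof. by apply/matrixP=> i j; rewrite !mxE linearP mulrDr mulrCA. Qed.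

Lemma tens_suml (V : vectType rat) n (c : 'I_n -> rat) (e : 'I_n -> V) (z : V) :
  tens (\sum_i c i *: e i) z = \sum_i c i *: tens (e i) z.
Proof.
elim/big_rec2: _ => [|i u v _ <-]; last by rewrite tensDl.
by apply/matrixP=> i j; rewrite !mxE linear0 mul0r.
Qed.

Lemma tens_sumr (V : vectType rat) n (c : 'I_n -> rat) (e : 'I_n -> V) (z : V) :
  tens z (\sum_i c i *: e i) = \sum_i c i *: tens z (e i).
Proof.
elim/big_rec2: _ => [|i u v _ <-]; last by rewrite tensDr.
by apply/matrixP=> i j; rewrite !mxE linear0 mulr0.
Qed.

Lemma wedgeC (V : vectType rat) (x y : V) : wedge x y = - wedge y x.
Proof. by rewrite /wedge opprB. Qed.

Lemma wedge_suml (V : vectType rat) n (c : 'I_n -> rat) (e : 'I_n -> V) z :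
  wedge (\sum_i c i *: e i) z = \sum_i c i *: wedge (e i) z.
Proof.
rewrite /wedge tens_suml tens_sumr -sumrB.
by apply: eq_bigr => i _; rewrite scalerBr.
Qed.

Lemma wedge_sumr (V : vectType rat) n (c : 'I_n -> rat) (e : 'I_n -> V) z :
  wedge z (\sum_i c i *: e i) = \sum_i c i *: wedge z (e i).
Proof.
rewrite wedgeC wedge_suml -sumrN.
by apply: eq_bigr => i _; rewrite [in RHS]wedgeC scalerN.
Qed.

Lemma mem_wedge2 (V : vectType rat) (x y : V) : wedge x y \in wedge2 V.
Proof.
rewrite (coord_vbasis (memvf x)) wedge_suml memv_suml // => i _.
rewrite memvZ // (coord_vbasis (memvf y)) wedge_sumr memv_suml // => j _.
by rewrite memvZ // memv_span // allpairs_f // mem_nth // size_tuple.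
Qed.

Lemma tens2_mapD (V W : vectType rat) (f : 'Hom(V, W)) (M : tens2 V) :
  tens2_map f M = \sum_i \sum_j (M : 'M[rat]_(\dim {:V})) i j *:
    tens (f (vbasis {:V})`_i) (f (vbasis {:V})`_j).
Proof.
rewrite /tens2_map; set F := fun _ => _.
have lF : linear F.
  move=> a A B; rewrite /F scaler_sumr -big_split; apply: eq_bigr => i _ /=.
  rewrite scaler_sumr -big_split; apply: eq_bigr => j _ /=.
  by rewrite !mxE scalerDl scalerA.
pose L := GRing.isLinear.Build _ _ _ _ F lF.
pose G : {linear tens2 V -> tens2 W} := HB.pack F L.
by rewrite -[F]/(G : _ -> _) lfunE.
Qed.

Lemma tens2_mapE (V W : vectType rat) (f : 'Hom(V, W)) (x y : V) :
  tens2_map f (tens x y) = tens (f x) (f y).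
Proof.
rewrite tens2_mapD [in RHS](coord_vbasis (memvf x)) linear_sum /=.
under [in RHS]eq_bigr do rewrite linearZ /=.
rewrite tens_suml; apply: eq_bigr => i _.
rewrite [in RHS](coord_vbasis (memvf y)) linear_sum /=.
under [in RHS]eq_bigr do rewrite linearZ /=.
rewrite tens_sumr scaler_sumr; apply: eq_bigr => j _.
by rewrite mxE scalerA.
Qed.

Lemma tens2_map_wedge (V W : vectType rat) (f : 'Hom(V, W)) (x y : V) :
  tens2_map f (wedge x y) = wedge (f x) (f y).
Proof. by rewrite linearB /= !tens2_mapE. Qed.

Lemma tens2_map_wedge2 (V W : vectType rat) (f : 'Hom(V, W)) :
  (tens2_map f @: wedge2 V <= wedge2 W)%VS.
Proof.
rewrite limg_span; apply/span_subvP=> _ /mapP[_ /allpairsP[u [_ _ ->]] ->].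
by rewrite tens2_map_wedge mem_wedge2.
Qed.

(* The objects (V, R) of QD^- over a fixed finite-dimensional V. *)
Record qdata (V : vectType rat) := QData {
  qrel :> {vspace tens2 V};
  qrel_wedge : (qrel <= wedge2 V)%VS
}.

Definition qd_hom (V W : vectType rat) (R : qdata V) (S : qdata W)
    (f : 'Hom(V, W)) : Prop :=
  (tens2_map f @: R <= S)%VS.

Section Oplus.
Variables V W : vectType rat.

Definition inl_hom : 'Hom(V, (V * W)%type) := linfun (fun v => (v, 0)).
Definition inr_hom : 'Hom(W, (V * W)%type) := linfun (fun w => (0, w)).

(* [V, W]_-, spanned by the v (x) w - w (x) v; see mem_qd_comm. *)
Definition qd_comm : {vspace tens2 (V * W)%type} :=
  <<[seq wedge (inl_hom v) (inr_hom w) | v <- vbasis {:V}, w <- vbasis {:W}]>>%VS.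

Definition oplus_rel (R : {vspace tens2 V}) (S : {vspace tens2 W}) :
    {vspace tens2 (V * W)%type} :=
  (tens2_map inl_hom @: R + qd_comm + tens2_map inr_hom @: S)%VS.

Lemma inl_homE v : inl_hom v = (v, 0).
Proof.
have lF : linear (fun v : V => (v, 0) : (V * W)%type).
  by move=> a x y; congr pair; rewrite /= scaler0 addr0.
pose G : {linear V -> (V * W)%type} :=
  HB.pack (fun v : V => (v, 0 : W)) (GRing.isLinear.Build _ _ _ _ _ lF).
by rewrite /inl_hom -[fun _ => _]/(G : _ -> _) lfunE.
Qed.

Lemma inr_homE w : inr_hom w = (0, w).
Proof.
have lF : linear (fun w : W => (0, w) : (V * W)%type).
  by move=> a x y; congr pair; rewrite /= scaler0 addr0.
pose G : {linear W -> (V * W)%type} :=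
  HB.pack (fun w : W => (0 : V, w)) (GRing.isLinear.Build _ _ _ _ _ lF).
by rewrite /inr_hom -[fun _ => _]/(G : _ -> _) lfunE.
Qed.

Lemma mem_qd_comm v w : wedge (inl_hom v) (inr_hom w) \in qd_comm.
Proof.
rewrite (coord_vbasis (memvf v)) linear_sum /=.
under eq_bigr do rewrite linearZ /=.
rewrite wedge_suml memv_suml // => i _.
rewrite memvZ // (coord_vbasis (memvf w)) linear_sum /=.
under eq_bigr do rewrite linearZ /=.
rewrite wedge_sumr memv_suml // => j _.
rewrite memvZ // memv_span //; apply/allpairsP.
by exists ((vbasis {:V})`_i, (vbasis {:W})`_j); rewrite !mem_nth ?size_tuple.
Qed.

Lemma oplus_rel_wedge (R : qdata V) (S : qdata W) :
  (oplus_rel R S <= wedge2 (V * W)%type)%VS.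
Proof.
rewrite !subv_add; apply/andP; split; last first.
  exact: subv_trans (limgS _ (qrel_wedge S)) (tens2_map_wedge2 _).
apply/andP; split.
  exact: subv_trans (limgS _ (qrel_wedge R)) (tens2_map_wedge2 _).
by apply/span_subvP=> _ /allpairsP[u [_ _ ->]]; apply: mem_wedge2.
Qed.

Definition oplus (R : qdata V) (S : qdata W) : qdata (V * W)%type :=
  QData (oplus_rel_wedge R S).

End Oplus.

(* Labels are 0-based, so p : 'I_n and the block of p is {p, ..., p + m - 1};
   collapse p is the map pi_p, and inner p is the shift of 'I_m onto the block.
   The arity k of a partial composite is kept apart from n + m - 1, with a proof
   of k + 1 = n + m, so that no transport along equalities of arities is needed
   to state the axioms. *)
Section Positions.
Variables (n m k : nat) (e : k.+1 = (n + m)%N).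

Lemma inner_subproof (p : 'I_n) (j : 'I_m) : (p + j < k)%N.
Proof. by have := ltn_ord p; have := ltn_ord j; lia. Qed.

Definition inner (p : 'I_n) (j : 'I_m) : 'I_k := Ordinal (inner_subproof p j).

Definition collapse_nat (p x : nat) : nat :=
  if (x < p)%N then x else if (x < p + m)%N then p else (x.+1 - m)%N.

Lemma collapse_subproof (p : 'I_n) (x : 'I_k) : (collapse_nat p x < n)%N.
Proof.
rewrite /collapse_nat; have px := ltn_ord p; have xk := ltn_ord x.
by case: ifP => ?; [|case: ifP => ?]; lia.
Qed.

Definition collapse (p : 'I_n) (x : 'I_k) : 'I_n :=
  Ordinal (collapse_subproof p x).

(* r is the block permutation s o_p t: it carries the p-th block to the
   (s p)-th block through t, and is induced by s on the other labels.  These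
   two conditions determine r, and such an r always exists. *)
Definition block_perm (p : 'I_n) (s : 'S_n) (t : 'S_m) (r : 'S_k) : Prop :=
  (forall x, collapse (s p) (r x) = s (collapse p x)) /\
  (forall j, r (inner p j) = inner (s p) (t j)).

End Positions.

(* A symmetric operad with components (V n, Q n), symmetric group actions act,
   partial compositions comp, and unit.  The unit is a morphism from the
   monoidal unit (0, 0) to (V 1, Q 1), hence necessarily the zero map: the
   identity element of the operad is 0 : V 1.
   Permutations act on the left by relabelling (in MathComp, (s * t) x is
   t (s x)), and equivariance is stated accordingly.
   In qop_par, x is the position of j in u o_i v, and y that of i in u o_j w. *)
Record qd_operad (V : nat -> vectType rat) (Q : forall n, qdata (V n))
    (act : forall n, 'S_n -> 'End(V n))
    (comp : forall n m k, k.+1 = (n + m)%N -> 'I_n ->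
              'Hom((V n * V m)%type, V k)) : Prop := QDOperad {
  qop_act_hom : forall n (s : 'S_n), qd_hom (Q n) (Q n) (act n s);
  qop_comp_hom : forall n m k (e : k.+1 = (n + m)%N) (p : 'I_n),
    qd_hom (oplus (Q n) (Q m)) (Q k) (comp n m k e p);
  qop_act1 : forall n (v : V n), act n 1%g v = v;
  qop_actM : forall n (s t : 'S_n) (v : V n),
    act n (s * t)%g v = act n t (act n s v);
  qop_unitr : forall n (e : n.+1 = (n + 1)%N) (p : 'I_n) (v : V n),
    comp n 1%N n e p (v, 0) = v;
  qop_unitl : forall n (e : n.+1 = (1 + n)%N) (p : 'I_1) (v : V n),
    comp 1%N n n e p (0, v) = v;
  qop_seq : forall l m n a b r (ea : a.+1 = (l + m)%N) (er : r.+1 = (a + n)%N)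
      (eb : b.+1 = (m + n)%N) (er' : r.+1 = (l + b)%N)
      (i : 'I_l) (j : 'I_m) (u : V l) (v : V m) (w : V n),
    comp a n r er (inner ea i j) (comp l m a ea i (u, v), w) =
    comp l b r er' i (u, comp m n b eb j (v, w));
  qop_par : forall l m n a b r (ea : a.+1 = (l + m)%N) (er : r.+1 = (a + n)%N)
      (eb : b.+1 = (l + n)%N) (er' : r.+1 = (b + m)%N)
      (i j : 'I_l) (x : 'I_a) (y : 'I_b) (u : V l) (v : V m) (w : V n),
    i != j -> collapse ea i x = j -> collapse eb j y = i ->
    comp a n r er x (comp l m a ea i (u, v), w) =
    comp b m r er' y (comp l n b eb j (u, w), v);
  qop_equiv : forall n m k (e : k.+1 = (n + m)%N) (p : 'I_n)
      (s : 'S_n) (t : 'S_m) (r : 'S_k) (u : V n) (v : V m),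
    block_perm e p s t r ->
    comp n m k e (s p) (act n s u, act m t v) = act k r (comp n m k e p (u, v))
}.

(* Q' is a sub-operad of the operad Q, with the same generators. *)
Definition qd_suboperad (V : nat -> vectType rat)
    (act : forall n, 'S_n -> 'End(V n))
    (comp : forall n m k, k.+1 = (n + m)%N -> 'I_n ->
              'Hom((V n * V m)%type, V k))
    (Q Q' : forall n, qdata (V n)) : Prop :=
  (forall n, (Q' n <= Q n)%VS) /\ qd_operad Q' act comp.

Definition smallest_qd_suboperad (V : nat -> vectType rat)
    (act : forall n, 'S_n -> 'End(V n))
    (comp : forall n m k, k.+1 = (n + m)%N -> 'I_n ->
              'Hom((V n * V m)%type, V k))
    (Q Q' : forall n, qdata (V n)) : Prop :=
  qd_suboperad act comp Q Q' /\
  (forall Q'' : forall n, qdata (V n),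
     qd_suboperad act comp Q Q'' -> forall n, (Q' n <= Q'' n)%VS).

Definition triple (n : nat) := {I : {set 'I_n} | #|I| == 3%N}.

Definition hgV (n : nat) : vectType rat := {ffun triple n -> rat^o}.

(* The basis vector t_A, for #|A| = 3 (and 0 for the other sets A). *)
Definition hgt (n : nat) (A : {set 'I_n}) : hgV n :=
  [ffun I : triple n => (val I == A)%:R].

Definition hg_act (n : nat) (s : 'S_n) : 'End(hgV n) :=
  linfun (fun x : hgV n => \sum_(I : triple n) x I *: hgt (s @: val I)).

Definition hg_comp (n m k : nat) (e : k.+1 = (n + m)%N) (p : 'I_n) :
    'Hom((hgV n * hgV m)%type, hgV k) :=
  linfun (fun x : (hgV n * hgV m)%type =>
    \sum_(I : triple n)
      x.1 I *: (\sum_(I' : {set 'I_k} | (#|I'| == 3%N) &&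
                                        (collapse e p @: I' == val I)) hgt I') +
    \sum_(J : triple m) x.2 J *: hgt (inner e p @: val J)).

Lemma hg_sum (n : nat) (U : lmodType rat) (A : triple n) (F : triple n -> U) :
  \sum_(I : triple n) hgt (val A) I *: F I = F A.
Proof.
rewrite (bigD1 A) //= ffunE eqxx scale1r big1 ?addr0 // => I neqIA.
by rewrite ffunE val_eqE (negPf neqIA) scale0r.
Qed.

Lemma hg_act_t (n : nat) (s : 'S_n) (I : triple n) :
  hg_act s (hgt (val I)) = hgt (s @: val I).
Proof.
rewrite /hg_act; set F := fun _ => _.
have lF : linear F.
  move=> a x y; rewrite /F scaler_sumr -big_split; apply: eq_bigr => J _ /=.
  by rewrite !ffunE scalerDl scalerA.
pose G : {linear hgV n -> hgV n} :=
  HB.pack F (GRing.isLinear.Build _ _ _ _ _ lF).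
by rewrite -[F]/(G : _ -> _) lfunE /= /F hg_sum.
Qed.

Lemma hg_compE (n m k : nat) (e : k.+1 = (n + m)%N) (p : 'I_n) u v :
  hg_comp e p (u, v) =
    \sum_(I : triple n)
      u I *: (\sum_(I' : {set 'I_k} | (#|I'| == 3%N) &&
                                      (collapse e p @: I' == val I)) hgt I') +
    \sum_(J : triple m) v J *: hgt (inner e p @: val J).
Proof.
rewrite /hg_comp; set F := fun _ => _.
have lF : linear F.
  move=> a x y; rewrite /F scalerDr addrACA !scaler_sumr -!big_split /=.
  congr (_ + _); apply: eq_bigr => J _ /=.
    by rewrite !ffunE scalerDl scalerA.
  by rewrite !ffunE scalerDl scalerA.
pose G : {linear (hgV n * hgV m)%type -> hgV k} :=
  HB.pack F (GRing.isLinear.Build _ _ _ _ _ lF).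
by rewrite -[F]/(G : _ -> _) lfunE.
Qed.

Lemma hg_comp_tl (n m k : nat) (e : k.+1 = (n + m)%N) p (I : triple n) :
  hg_comp e p (hgt (val I), 0) =
  \sum_(I' : {set 'I_k} | (#|I'| == 3%N) && (collapse e p @: I' == val I))
    hgt I'.
Proof.
rewrite hg_compE hg_sum [X in _ + X]big1 ?addr0 // => J _.
by rewrite ffunE scale0r.
Qed.

Lemma hg_comp_tr (n m k : nat) (e : k.+1 = (n + m)%N) p (J : triple m) :
  hg_comp e p (0, hgt (val J)) = hgt (inner e p @: val J).
Proof.
rewrite hg_compE hg_sum big1 ?add0r // => I _.
by rewrite ffunE scale0r.
Qed.

Definition HG (n : nat) : qdata (hgV n) := QData (subvv (wedge2 (hgV n))).

Definition ehkr_rel (n : nat) : {vspace tens2 (hgV n)} :=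
  (\sum_(I : {set 'I_n} | #|I| == 3%N)
     \sum_(J : {set 'I_n} | (#|J| == 3%N) && [disjoint I & J])
       <[wedge (hgt I) (hgt J)]> +
   \sum_(i : 'I_n) \sum_(j : 'I_n) \sum_(k : 'I_n) \sum_(l : 'I_n)
     \sum_(m : 'I_n | uniq [:: i; j; k; l; m])
       <[wedge (hgt [set i; j; k])
               (hgt [set l; m; i] + hgt [set l; m; j] + hgt [set l; m; k])]>)%VS.

Lemma ehkr_rel_wedge (n : nat) : (ehkr_rel n <= wedge2 (hgV n))%VS.
Proof.
rewrite subv_add; apply/andP; split.
  do 2! [apply/subv_sumP=> ? _].
  by rewrite -memvE mem_wedge2.
do 5! [apply/subv_sumP=> ? _].
by rewrite -memvE mem_wedge2.
Qed.

Definition EHKR (n : nat) : qdata (hgV n) := QData (ehkr_rel_wedge n).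

(* Main.v *)
Require Import Defs.
From HB Require Import structures.
From mathcomp Require Import all_boot all_order all_algebra all_fingroup zify.

Set Implicit Arguments.
Unset Strict Implicit.
Unset Printing Implicit Defensive.

Import GRing.Theory.
Local Open Scope ring_scope.

(** The coefficient function of a vector of [hgV n], extended by 0 to the sets
    that are not triples, makes the operad structure contravariant and free of
    sums.  Every map [f] of labels has a pullback [pull f], the coefficient of
    [pull f u] at [A] being that of [u] at [f @: A], and every injective map [g]
    has a pushforward [push g], the coefficient of [push g v] at [A] being that
    of [v] at [g @^-1: A].  The extension by 0 absorbs the triples on which [f]
    is not injective, and those that are not in the image of [g].  Permutations
    act by pushforward, and [u o_p v] is the pullback of [u] along the collapse
    of the block plus the pushforward of [v] along its inclusion
    ([hg_comp_pull_push]).  The operad axioms thus reduce to identities between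
    images and preimages of a set of labels.

    The relations of EHKR are best written [t_A /\ \sum_(a in A) t_(l, m, a)],
    with [l] and [m] outside of [A].  Since the triples [A] and [l, m, a] are
    disjoint when [a] is not in [A], one may sum over any set [X] that contains
    [A] ([wedge_star]).  This freedom is what makes EHKR stable under all the structure maps:
    - a pullback replaces [A] by the triples [B] mapped onto it and the sum over
      [A] by a sum over its preimage, which contains [B] ([pull_qd_hom]);
    - the wedge of a pulled back and of a pushed forward triple is either
      disjoint or, if the outer triple contains the label [p], a sum over the
      whole block, which contains the inner triple ([wedge_pull_push]).

    The second computation also shows minimality.  In a sub-operad, all the
    wedges [pull u /\ push v] must be relations, because the monoidal product
    contains [[V, W]_-] ([operad_wedge]).  When [v] is the generator of arity 3,
    the block is itself a triple [P], and these wedges are exactly the EHKR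
    relations whose first factor is [t_P] ([operad_block_rel]).  As permutations are transitive on triples, these give
    all the relations of EHKR. *)

(** * Finite sets and permutations *)

Lemma perm_extends (T : finType) (s t : seq T) :
  uniq s -> uniq t -> size s = size t -> exists g : {perm T}, map g s = t.
Proof.
elim: s t => [|x s IHs] [|y t] //=; first by exists 1%g.
move=> /andP[xs us] /andP[yt ut] [est]; have [g gst] := IHs t us ut est.
exists (g * tperm (g x) y)%g; rewrite permM tpermL; congr cons.
rewrite -[RHS]gst; apply/eq_in_map => z zs.
rewrite permM tpermD // ?(inj_eq perm_inj); first by apply: contraNneq xs => ->.
by apply: contraNneq yt => ->; rewrite -gst map_f.
Qed.

Lemma perm_imset_card (T : finType) (A B : {set T}) :
  #|A| = #|B| -> exists g : {perm T}, g @: A = B.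
Proof.
rewrite !cardE => eAB.
have [g gAB] := perm_extends (enum_uniq A) (enum_uniq B) eAB.
exists g; apply/setP=> y; rewrite -[in RHS]mem_enum -gAB.
apply/imsetP/mapP => -[x xA ->]; exists x => //; move: xA;
  by rewrite mem_enum.
Qed.

Lemma preimset_imset_inj (S T : finType) (f : S -> T) (A : {set S}) :
  injective f -> f @^-1: (f @: A) = A.
Proof. by move=> fI; apply/setP=> x; rewrite inE mem_imset. Qed.

Lemma leq_preimset (S T : finType) (f : S -> T) (A : {set T}) :
  injective f -> (#|f @^-1: A| <= #|A|)%N.
Proof.
move=> fI; rewrite -(card_imset _ fI); apply/subset_leq_card/subsetP=> y.
by move=> /imsetP[x xA ->]; rewrite inE in xA.
Qed.

(** Beck-Chevalley for images and preimages, along a commutative square whose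
    upper left corner maps onto the fibre product. *)
Lemma preimset_imset_square (S T S' T' : finType) (f : S -> T) (g : S' -> T')
    (h : S' -> S) (h' : T' -> T) (A : {set S}) :
  (forall x y, f x = h' y <-> exists2 z, h z = x & g z = y) ->
  h' @^-1: (f @: A) = g @: (h @^-1: A).
Proof.
move=> cart; apply/setP=> y; rewrite inE; apply/imsetP/imsetP.
  case=> x xA /esym/cart[z ezx <-]; exists z => //; by rewrite inE ezx.
case=> z; rewrite inE => zA ->; exists (h z) => //.
by apply/esym/cart; exists z.
Qed.

Lemma cards3_uniq (T : finType) (i j k : T) :
  (#|[set i; j; k]| == 3%N) = uniq [:: i; j; k].
Proof.
rewrite setUC cardsU1 cards2 !inE /= inE negb_or !andbT.
rewrite (eq_sym k i) (eq_sym k j) !inE.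
by case: (i == k); case: (j == k); case: (i == j).
Qed.

Lemma cards3_memP (T : finType) (A : {set T}) (p : T) :
  #|A| == 3%N -> p \in A ->
  exists l k, [/\ l != k, l != p, k != p & A = [set l; k; p]].
Proof.
move=> A3 pA; move: A3; rewrite (cardsD1 p) pA => /cards2P[l [k [lk eA]]].
exists l, k; rewrite -(setD1K pA) eA setUC; split=> //.
  by have := set21 l k; rewrite -eA => /setD1P[].
by have := set22 l k; rewrite -eA => /setD1P[].
Qed.

Lemma cards3P (T : finType) (A : {set T}) :
  #|A| == 3%N -> exists i j k, A = [set i; j; k].
Proof.
move=> A3; have /card_gt0P[k kA] : (0 < #|A|)%N by rewrite (eqP A3).
by have [i [j [_ _ _ ->]]] := cards3_memP A3 kA; exists i, j, k.
Qed.

Lemma big_set3 (T : finType) (V : zmodType) (F : T -> V) (i j k : T) :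
  uniq [:: i; j; k] -> \sum_(a in [set i; j; k]) F a = F i + F j + F k.
Proof.
move=> /=; rewrite !inE negb_or andbT => /andP[/andP[ij ik] jk].
rewrite setUC !big_setU1 ?inE ?big_set1 ?negb_or /=.
- by rewrite addrC.
- by rewrite ij.
- by rewrite eq_sym ik eq_sym jk.
Qed.

(** * Wedges and morphisms of quadratic data *)

Section Wedge.
Variable V : vectType rat.

Lemma wedge_is_linear (z : V) : linear (wedge z).
Proof.
move=> a x y; rewrite /wedge tensDl tensDr scalerBr.
by rewrite opprD addrACA.
Qed.

HB.instance Definition _ (z : V) :=
  GRing.isLinear.Build _ _ _ _ (wedge z) (wedge_is_linear z).

Lemma memv_wedgeC (U : {vspace tens2 V}) (x y : V) :
  (wedge x y \in U) = (wedge y x \in U).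
Proof. by rewrite wedgeC rpredN. Qed.

Lemma memv_wedge_sumr (U : {vspace tens2 V}) (I : finType) (P : pred I)
    (F : I -> V) (x : V) :
  (forall i, P i -> wedge x (F i) \in U) -> wedge x (\sum_(i | P i) F i) \in U.
Proof. by move=> FU; rewrite linear_sum memv_suml. Qed.

Lemma memv_wedge_suml (U : {vspace tens2 V}) (I : finType) (P : pred I)
    (F : I -> V) (x : V) :
  (forall i, P i -> wedge (F i) x \in U) -> wedge (\sum_(i | P i) F i) x \in U.
Proof.
move=> FU; rewrite memv_wedgeC memv_wedge_sumr // => i Pi.
by rewrite memv_wedgeC FU.
Qed.

Lemma memv_wedgeZ (U : {vspace tens2 V}) (a b : rat) (x y : V) :
  wedge x y \in U -> wedge (a *: x) (b *: y) \in U.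
Proof.
by move=> xyU; rewrite linearZ memvZ // memv_wedgeC linearZ memvZ // memv_wedgeC.
Qed.

End Wedge.

Lemma tens2_map_comp (U V W : vectType rat) (g : 'Hom(V, W)) (f : 'Hom(U, V)) :
  (tens2_map g \o tens2_map f)%VF = tens2_map (g \o f)%VF.
Proof.
apply/lfunP=> M; rewrite lfunE /= (tens2_mapD f) (tens2_mapD (g \o f)%VF).
rewrite linear_sum /=.
apply: eq_bigr => i _; rewrite linear_sum /=; apply: eq_bigr => j _.
by rewrite linearZ /= tens2_mapE !lfunE.
Qed.

(** In the form of an inclusion into a preimage, it is enough to check a
    morphism on generators of the relations of the source. *)
Lemma qd_homP (V W : vectType rat) (R : qdata V) (S : qdata W) (f : 'Hom(V, W)) :
  qd_hom R S f <-> (R <= tens2_map f @^-1: S)%VS.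
Proof.
split=> [fRS | /subvP RfS]; apply/subvP=> M.
  by move=> MR; rewrite -memv_preim (subvP fRS) // memv_img.
by case/memv_imgP=> N NR ->; rewrite memv_preim RfS.
Qed.

Lemma qd_hom_oplus (V W X : vectType rat) (R : qdata V) (S : qdata W)
    (T : qdata X) (f : 'Hom((V * W)%type, X)) :
  qd_hom R T (f \o inl_hom V W)%VF -> qd_hom S T (f \o inr_hom V W)%VF ->
  (forall v w, wedge (f (v, 0)) (f (0, w)) \in T) ->
  qd_hom (oplus R S) T f.
Proof.
rewrite /qd_hom -!tens2_map_comp !limg_comp => fR fS fVW.
rewrite /= /oplus_rel !limgD !subv_add fR fS andbT /=.
rewrite limg_span; apply/span_subvP=> _ /mapP[_ /allpairsP[u [_ _ ->]] ->].
rewrite tens2_map_wedge inl_homE inr_homE; exact: fVW.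
Qed.

(** * Coefficients of hypergraph generators *)

Section Coef.
Variable n : nat.
Implicit Types (u v : hgV n) (A B : {set 'I_n}).

(** The value 0 off the triples lets [hgcoef] be evaluated at images and
    preimages of a triple, which may have fewer than three elements. *)
Definition hgcoef v A : rat := oapp v 0 (insub A : option (triple n)).

Lemma hgcoefD u v A : hgcoef (u + v) A = hgcoef u A + hgcoef v A.
Proof. by rewrite /hgcoef; case: insub => [I|] /=; rewrite ?ffunE ?addr0. Qed.

Lemma hgcoefZ (a : rat) v A : hgcoef (a *: v) A = a * hgcoef v A.
Proof. by rewrite /hgcoef; case: insub => [I|] /=; rewrite ?ffunE ?mulr0. Qed.

Lemma hgcoef0 A : hgcoef 0 A = 0.
Proof. by rewrite /hgcoef; case: insub => [I|] //=; rewrite ffunE. Qed.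

Lemma hgcoef_sum (I : finType) (P : pred I) (F : I -> hgV n) A :
  hgcoef (\sum_(i | P i) F i) A = \sum_(i | P i) hgcoef (F i) A.
Proof. by apply: (big_morph (hgcoef^~ A)) => [u v|]; rewrite ?hgcoefD ?hgcoef0. Qed.

Lemma hgcoef_triple v (I : triple n) : hgcoef v (val I) = v I.
Proof. by rewrite /hgcoef valK. Qed.

Lemma hgcoef_small v A : (#|A| < 3)%N -> hgcoef v A = 0.
Proof. by move=> A3; rewrite /hgcoef insubF //; case: eqP A3 => // ->. Qed.

Lemma hgcoefP u v : (forall A, #|A| == 3%N -> hgcoef u A = hgcoef v A) -> u = v.
Proof.
move=> euv; apply/ffunP=> I; rewrite -!hgcoef_triple; exact: euv (valP I).
Qed.

Lemma hgcoef_hgt A B : hgcoef (hgt A) B = ((#|B| == 3%N) && (B == A))%:R.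
Proof.
by rewrite /hgcoef; case: insubP => [I -> <- | /negPf->] //=; rewrite ffunE.
Qed.

Lemma hgt0 A : #|A| != 3%N -> hgt A = 0.
Proof.
move=> A3; apply: hgcoefP => B B3; rewrite hgcoef_hgt hgcoef0.
case: (B =P A) => [eBA | _]; last by rewrite andbF.
by rewrite -eBA B3 in A3.
Qed.

Lemma tripleP A : #|A| == 3%N -> exists I : triple n, val I = A.
Proof. by move=> A3; exists (exist _ A A3). Qed.

Lemma hgt_expand v : v = \sum_(I : triple n) v I *: hgt (val I).
Proof.
apply: hgcoefP => _ /tripleP[J <-]; rewrite hgcoef_sum hgcoef_triple (bigD1 J) //=.
rewrite hgcoefZ hgcoef_hgt (valP J) eqxx mulr1 big1 ?addr0 // => I neIJ.
by rewrite hgcoefZ hgcoef_hgt val_eqE (eq_sym J) (negPf neIJ) andbF mulr0.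
Qed.

End Coef.

(** * Pullback and pushforward along maps of labels *)

Section PullPush.
Variables n m : nat.

Definition pull_fun (f : 'I_m -> 'I_n) (u : hgV n) : hgV m :=
  [ffun A : triple m => hgcoef u (f @: val A)].

Definition push_fun (g : 'I_m -> 'I_n) (v : hgV m) : hgV n :=
  [ffun A : triple n => hgcoef v (g @^-1: val A)].

Lemma pull_is_linear f : linear (pull_fun f).
Proof. by move=> a u v; apply/ffunP=> A; rewrite !ffunE hgcoefD hgcoefZ. Qed.

Lemma push_is_linear f : linear (push_fun f).
Proof. by move=> a u v; apply/ffunP=> A; rewrite !ffunE hgcoefD hgcoefZ. Qed.

HB.instance Definition _ f :=
  GRing.isLinear.Build _ _ _ _ (pull_fun f) (pull_is_linear f).
HB.instance Definition _ f :=
  GRing.isLinear.Build _ _ _ _ (push_fun f) (push_is_linear f).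

Definition pull f : 'Hom(hgV n, hgV m) := linfun (pull_fun f).
Definition push g : 'Hom(hgV m, hgV n) := linfun (push_fun g).

(** The bound on [#|A|], weaker than [#|A| = 3], is what lets the formula be
    iterated: images and preimages of [A] may be smaller than [A].  On larger
    sets it fails, since they may be mapped onto a triple. *)
Lemma hgcoef_pull f u (A : {set 'I_m}) :
  (#|A| <= 3)%N -> hgcoef (pull f u) A = hgcoef u (f @: A).
Proof.
rewrite leq_eqVlt => /predU1P[/eqP A3 | A3]; last first.
  by rewrite !hgcoef_small // (leq_ltn_trans (leq_imset_card _ _)).
by have [I <-] := tripleP A3; rewrite hgcoef_triple lfunE /= ffunE.
Qed.

Lemma hgcoef_push g v (A : {set 'I_n}) :
  injective g -> (#|A| <= 3)%N -> hgcoef (push g v) A = hgcoef v (g @^-1: A).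
Proof.
move=> gI; rewrite leq_eqVlt => /predU1P[/eqP A3 | A3]; last first.
  by rewrite !hgcoef_small // (leq_ltn_trans (leq_preimset _ gI)).
by have [I <-] := tripleP A3; rewrite hgcoef_triple lfunE /= ffunE.
Qed.

Lemma pull_hgt f (I : {set 'I_n}) : #|I| == 3%N ->
  pull f (hgt I) = \sum_(A : {set 'I_m} | (#|A| == 3%N) && (f @: A == I)) hgt A.
Proof.
move=> I3; apply: hgcoefP => A A3; rewrite hgcoef_pull ?(eqP A3) // hgcoef_hgt.
rewrite hgcoef_sum; case: (f @: A =P I) => [fA | nfA]; last first.
  rewrite andbF big1 // => B /andP[_ /eqP fB]; rewrite hgcoef_hgt.
  by case: (A =P B) => [eAB|]; [case: nfA; rewrite eAB | rewrite andbF].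
rewrite (bigD1 A) /=; last by rewrite A3 fA eqxx.
rewrite hgcoef_hgt A3 eqxx fA I3 big1 ?addr0 // => B /andP[_ neBA].
by rewrite hgcoef_hgt (eq_sym A) (negPf neBA) andbF.
Qed.

Lemma push_hgt g (J : {set 'I_m}) :
  injective g -> push g (hgt J) = hgt (g @: J).
Proof.
move=> gI; apply: hgcoefP => A A3; rewrite hgcoef_push ?(eqP A3) //.
rewrite !hgcoef_hgt A3 /=.
case: (A =P g @: J) => [eA | neA].
  by rewrite eA preimset_imset_inj // eqxx andbT -(card_imset _ gI) -eA A3.
case: (_ =P 3%N) => //= A3'; case: (_ =P J) => // eJ; case: neA.
apply/esym/eqP; rewrite eqEcard -eJ card_imset // A3' (eqP A3) leqnn andbT.
by apply/subsetP=> y /imsetP[x xJ ->]; rewrite inE in xJ.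
Qed.

End PullPush.

(** * The operad axioms *)

Lemma inner_inj n m k (e : k.+1 = (n + m)%N) p : injective (inner e p).
Proof. by move=> x y /(congr1 val) /= /addnI /val_inj. Qed.

Lemma hg_comp_pull_push n m k (e : k.+1 = (n + m)%N) p (u : hgV n) (v : hgV m) :
  hg_comp e p (u, v) = pull (collapse e p) u + push (inner e p) v.
Proof.
rewrite hg_compE {2}(hgt_expand u) {2}(hgt_expand v) !linear_sum /=.
congr (_ + _); apply: eq_bigr => I _; rewrite linearZ /=.
  by rewrite pull_hgt ?(valP I).
by rewrite push_hgt //; apply: inner_inj.
Qed.

Lemma hg_act_push n (s : 'S_n) : hg_act s = push s.
Proof.
apply/lfunP=> v; rewrite {1 2}(hgt_expand v) !linear_sum /=.
apply: eq_bigr => I _.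
by rewrite !linearZ /= hg_act_t push_hgt //; apply: perm_inj.
Qed.

Lemma hgcoef_act n (s : 'S_n) (v : hgV n) (A : {set 'I_n}) :
  (#|A| <= 3)%N ->
  hgcoef (hg_act s v) A = hgcoef v (s @^-1: A).
Proof. by move=> A3; rewrite hg_act_push hgcoef_push //; apply: perm_inj. Qed.

Lemma hgcoef_comp n m k (e : k.+1 = (n + m)%N) p (u : hgV n) (v : hgV m)
    (A : {set 'I_k}) :
  (#|A| <= 3)%N ->
  hgcoef (hg_comp e p (u, v)) A =
    hgcoef u (collapse e p @: A) + hgcoef v (inner e p @^-1: A).
Proof.
move=> A3; rewrite hg_comp_pull_push hgcoefD hgcoef_pull //.
by rewrite hgcoef_push //; apply: inner_inj.
Qed.

(** A specification by a disjunction rather than by nested conditionals, for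
    linear arithmetic to use. *)
Lemma collapse_natP m p x :
  (x < p)%N /\ collapse_nat m p x = x \/
  (p <= x < p + m)%N /\ collapse_nat m p x = p \/
  (p + m <= x)%N /\ collapse_nat m p x = (x.+1 - m)%N.
Proof.
rewrite /collapse_nat; case: ltnP => px; first by left.
by case: ltnP => xpm; right; [left | right].
Qed.

Lemma hg_act1 n (v : hgV n) : hg_act 1%g v = v.
Proof.
apply: hgcoefP => A A3; rewrite hgcoef_act ?(eqP A3) //; congr hgcoef.
by apply/setP=> x; rewrite inE perm1.
Qed.

Lemma hg_actM n (s t : 'S_n) (v : hgV n) :
  hg_act (s * t)%g v = hg_act t (hg_act s v).
Proof.
apply: hgcoefP => A A3; rewrite !hgcoef_act ?card_preimset ?(eqP A3) //; last first.
  exact: perm_inj.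
by congr hgcoef; apply/setP=> x; rewrite !inE permM.
Qed.

Lemma hg_unitr n (e : n.+1 = (n + 1)%N) (p : 'I_n) (v : hgV n) :
  hg_comp e p (v, 0 : hgV 1) = v.
Proof.
apply: hgcoefP => A A3; rewrite hgcoef_comp ?(eqP A3) // hgcoef0 addr0.
congr hgcoef.
rewrite -[RHS]imset_id; apply: eq_imset => x; apply: val_inj => /=.
by rewrite /collapse_nat; case: ifP => // ?; case: ifP => ?; lia.
Qed.

Lemma hg_unitl n (e : n.+1 = (1 + n)%N) (p : 'I_1) (v : hgV n) :
  hg_comp e p (0 : hgV 1, v) = v.
Proof.
apply: hgcoefP => A A3; rewrite hgcoef_comp ?(eqP A3) // hgcoef0 add0r.
congr hgcoef.
apply/setP=> x; rewrite inE; congr (_ \in A); apply: val_inj => /=.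
by rewrite (ord1 p).
Qed.

(** The three inputs give three identities of sets: a composite of collapses, a
    pullback square for the middle block, and a composite of inclusions. *)
Lemma hg_seq l m n a b r (ea : a.+1 = (l + m)%N) (er : r.+1 = (a + n)%N)
    (eb : b.+1 = (m + n)%N) (er' : r.+1 = (l + b)%N)
    (i : 'I_l) (j : 'I_m) (u : hgV l) (v : hgV m) (w : hgV n) :
  hg_comp er (inner ea i j) (hg_comp ea i (u, v), w) =
  hg_comp er' i (u, hg_comp eb j (v, w)).
Proof.
apply: hgcoefP => A /eqP A3.
have cA : (#|collapse er (inner ea i j) @: A| <= 3)%N.
  by rewrite -A3 leq_imset_card.
have iA : (#|inner er' i @^-1: A| <= 3)%N.
  by rewrite -A3 leq_preimset //; apply: inner_inj.
rewrite !hgcoef_comp ?A3 // -addrA; congr (_ + (_ + _)); congr hgcoef.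
- rewrite -imset_comp; apply: eq_imset => x; apply: val_inj => /=.
  have := collapse_natP n (i + j) x; have := collapse_natP b i x.
  have := collapse_natP m i (collapse_nat n (i + j) x).
  by have := ltn_ord j; lia.
- apply: preimset_imset_square => x y; split.
    have := ltn_ord x; have := ltn_ord y; have := ltn_ord j.
    move=> jm ym xr /(congr1 val) /= exy.
    have cx := collapse_natP n (i + j) x; have cz := collapse_natP n j (x - i).
    have xb : (x - i < b)%N by lia.
    by exists (Ordinal xb); apply: val_inj => /=; lia.
  case=> z <- <-; apply: val_inj => /=.
  by have := collapse_natP n (i + j) (i + z); have := collapse_natP n j z; lia.
- apply/setP=> x; rewrite !inE; congr (_ \in A); apply: val_inj => /=.
  by rewrite addnA.
Qed.

(** Substituting at [j] only moves the block of [i], because [j] is not [i]. *)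
Lemma inner_preim_collapse l m n a b r (ea : a.+1 = (l + m)%N)
    (er : r.+1 = (a + n)%N) (eb : b.+1 = (l + n)%N) (er' : r.+1 = (b + m)%N)
    (i j : 'I_l) (x : 'I_a) (y : 'I_b) (A : {set 'I_r}) :
  i != j -> collapse ea i x = j -> collapse eb j y = i ->
  inner ea i @^-1: (collapse er x @: A) = inner er' y @^-1: A.
Proof.
rewrite -val_eqE => /= neij /(congr1 val) /= ex /(congr1 val) /= ey.
have := collapse_natP m i x; have := collapse_natP n j y => cy cx.
rewrite -[RHS]imset_id; apply: preimset_imset_square => z t; split.
  move=> /(congr1 val) /= ez; exists t => //; apply: val_inj => /=.
  by have := collapse_natP n x z; have := ltn_ord t; lia.
case=> _ <- ->; apply: val_inj => /=.
by have := collapse_natP n x (y + t); have := ltn_ord t; lia.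
Qed.

Lemma hg_par l m n a b r (ea : a.+1 = (l + m)%N) (er : r.+1 = (a + n)%N)
    (eb : b.+1 = (l + n)%N) (er' : r.+1 = (b + m)%N)
    (i j : 'I_l) (x : 'I_a) (y : 'I_b) (u : hgV l) (v : hgV m) (w : hgV n) :
  i != j -> collapse ea i x = j -> collapse eb j y = i ->
  hg_comp er x (hg_comp ea i (u, v), w) =
  hg_comp er' y (hg_comp eb j (u, w), v).
Proof.
move=> neij ex ey; apply: hgcoefP => A /eqP A3.
have cA c d (f : 'I_c -> 'I_d) (B : {set 'I_c}) :
  #|B| = 3%N -> (#|f @: B| <= 3)%N by move=> <-; apply: leq_imset_card.
rewrite !hgcoef_comp ?cA ?A3 // -!addrA; congr (_ + _).
  congr hgcoef; rewrite -!imset_comp; apply: eq_imset => z; apply: val_inj => /=.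
  (* Solving for [x] and [y] first keeps the case analysis small. *)
  have exy : (i < j)%N /\ x.+1 = (j + m)%N /\ y = i :> nat \/
             (j < i)%N /\ x = j :> nat /\ y.+1 = (i + n)%N.
    have := collapse_natP m i x; have := collapse_natP n j y.
    move: neij (congr1 val ex) (congr1 val ey); rewrite -val_eqE /=; lia.
  have := collapse_natP n x z; have := collapse_natP m y z.
  have := collapse_natP m i (collapse_nat n x z).
  have := collapse_natP n j (collapse_nat m y z).
  set c := collapse_nat n x z; set d := collapse_nat m y z.
  set c' := collapse_nat m i c; set d' := collapse_nat n j d; clearbody c d c' d'.
  by case: exy => exy; clear - exy; lia.
rewrite (inner_preim_collapse (eb := eb) er er' A neij ex ey).
rewrite (inner_preim_collapse (eb := ea) er' er A _ ey ex) 1?eq_sym //.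
by rewrite addrC.
Qed.

Lemma hg_equiv n m k (e : k.+1 = (n + m)%N) (p : 'I_n)
    (s : 'S_n) (t : 'S_m) (r : 'S_k) (u : hgV n) (v : hgV m) :
  block_perm e p s t r ->
  hg_comp e (s p) (hg_act s u, hg_act t v) = hg_act r (hg_comp e p (u, v)).
Proof.
case=> er ei; apply: hgcoefP => A /eqP A3.
have cA : (#|collapse e (s p) @: A| <= 3)%N by rewrite -A3 leq_imset_card.
have iA : (#|inner e (s p) @^-1: A| <= 3)%N.
  by rewrite -A3 leq_preimset //; apply: inner_inj.
have rA : (#|r @^-1: A| <= 3)%N by rewrite -A3 leq_preimset //; apply: perm_inj.
rewrite hgcoef_comp ?A3 // !hgcoef_act ?A3 // hgcoef_comp //.
congr (_ + _); congr hgcoef.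
  apply: preimset_imset_square => x y; split=> [exy | [z <- <-]]; last exact: er.
  exists (r^-1%g x); first by rewrite permKV.
  by apply: (@perm_inj _ s); rewrite -er permKV.
by apply/setP=> x; rewrite !inE ei.
Qed.

(** * Relations of EHKR *)

(** The sum over [A] does not depend on an ordering of the triple, so that
    images under maps of labels can be taken termwise. *)
Lemma ehkr_rel_sub n (U : {vspace tens2 (hgV n)}) :
  (forall I J : {set 'I_n}, #|I| == 3%N -> #|J| == 3%N -> [disjoint I & J] ->
     wedge (hgt I) (hgt J) \in U) ->
  (forall (A : {set 'I_n}) (l m : 'I_n),
     #|A| == 3%N -> l \notin A -> m \notin A -> l != m ->
     wedge (hgt A) (\sum_(a in A) hgt [set l; m; a]) \in U) ->
  (ehkr_rel n <= U)%VS.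
Proof.
move=> dU sU; rewrite subv_add; apply/andP; split.
  apply/subv_sumP=> I I3; apply/subv_sumP=> J /andP[J3 dIJ].
  by rewrite -memvE dU.
apply/subv_sumP=> i _; apply/subv_sumP=> j _; apply/subv_sumP=> k _.
apply/subv_sumP=> l _; apply/subv_sumP=> m u.
have /and3P[u3 lmA lm] : [&& uniq [:: i; j; k], ~~ has (mem [:: i; j; k]) [:: l; m]
    & l != m].
  have <- : uniq [:: l; m] = (l != m) by rewrite /= inE andbT.
  by rewrite -cat_uniq.
rewrite -memvE -(big_set3 (fun a => hgt [set l; m; a])) // sU ?cards3_uniq //.
- by have := hasPn lmA l; rewrite !inE eqxx -!orbA; apply.
- by have := hasPn lmA m; rewrite !inE eqxx orbT -!orbA; apply.
Qed.

Lemma wedge_disjoint n (I J : {set 'I_n}) :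
  [disjoint I & J] -> wedge (hgt I) (hgt J) \in ehkr_rel n.
Proof.
move=> dIJ; case: (boolP (#|I| == 3%N)) => [I3 | /hgt0->]; last first.
  by rewrite memv_wedgeC linear0 mem0v.
case: (boolP (#|J| == 3%N)) => [J3 | /hgt0->]; last by rewrite linear0 mem0v.
apply: (subvP (addvSl _ _)); rewrite memvE (sumv_sup I) // (sumv_sup J) //.
by rewrite J3.
Qed.

(** The terms with [a] outside of [A] are relations by disjointness, so the sum
    may be enlarged from [A] to [X].  The terms with repeated labels, such as
    those with [a = l], vanish. *)
Lemma wedge_star n (A X : {set 'I_n}) (l m : 'I_n) :
  A \subset X -> l \notin A -> m \notin A ->
  wedge (hgt A) (\sum_(a in X) hgt [set l; m; a]) \in ehkr_rel n.
Proof.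
move=> /setIidPr AX lA mA; rewrite (big_setID A) AX linearD /=.
rewrite rpredD //; last first.
  apply: memv_wedge_sumr => a /setDP[_ aA]; apply: wedge_disjoint.
  rewrite disjoint_sym; apply/pred0P=> b /=; rewrite !inE.
  by apply/negP=> /andP[/orP[/orP[]|] /eqP->]; apply/negP.
have [-> | neq_lm] := eqVneq l m.
  rewrite big1 ?linear0 ?mem0v // => a _; apply: hgt0.
  by rewrite cards3_uniq /= inE eqxx.
case: (boolP (#|A| == 3%N)) => [A3 | /hgt0->]; last first.
  by rewrite memv_wedgeC linear0 mem0v.
have [i [j [k eA]]] := cards3P A3; rewrite eA cards3_uniq in A3 lA mA *.
have u : uniq [:: i; j; k; l; m].
  rewrite -[_ :: _]/([:: i; j; k] ++ [:: l; m]) cat_uniq A3 andTb; apply/andP.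
  split; last by rewrite /= inE andbT.
  by apply/hasPn=> x; move: lA mA; rewrite !inE -!orbA => ? ? /orP[]/eqP->.
apply: (subvP (addvSr _ _)); rewrite big_set3 // memvE.
rewrite (sumv_sup i) // (sumv_sup j) // (sumv_sup k) // (sumv_sup l) //.
by rewrite (sumv_sup m).
Qed.

(** * Pullback, pushforward and composition preserve the relations *)

Section PullRel.
Variables (n m : nat) (f : 'I_m -> 'I_n).

(** A triple of [D] below lists an element of each of the three fibres.  These
    fibres are disjoint, hence the set of its entries determines it. *)
Lemma pull_hgt3 (l k i : 'I_n) : uniq [:: l; k; i] ->
  pull f (hgt [set l; k; i]) =
  \sum_(d | f d == l) \sum_(e | f e == k) \sum_(a | f a == i) hgt [set d; e; a].
Proof.
move=> u; rewrite pull_hgt ?cards3_uniq // pair_big /= pair_big /=.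
pose D := [set t : 'I_m * 'I_m * 'I_m |
  (f t.1.1 == l) && (f t.1.2 == k) && (f t.2 == i)].
pose h (t : 'I_m * 'I_m * 'I_m) := [set t.1.1; t.1.2; t.2].
have /andP[/norP[lk li] ki] : ~~ [|| l == k | l == i] && (k != i).
  by move: u; rewrite /= !inE andbT.
have u3 d e a : f d = l -> f e = k -> f a = i -> #|[set d; e; a]| == 3%N.
  by move=> fd fe fa; rewrite cards3_uniq (@map_uniq _ _ f) //= fd fe fa.
have hD x t : t \in D -> x \in h t ->
    [/\ f x = l -> x = t.1.1, f x = k -> x = t.1.2 & f x = i -> x = t.2].
  case: t => [[d e] a]; rewrite !inE /= => /andP[/andP[/eqP fd /eqP fe] /eqP fa].
  have ne := (negPf lk, negPf li, negPf ki, eq_sym k l, eq_sym i l, eq_sym i k).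
  case/orP => [/orP[]|] /eqP->; rewrite ?fd ?fe ?fa.
  - by split=> // /eqP; rewrite ?ne.
  - by split=> // /eqP; rewrite ?ne.
  - by split=> // /eqP; rewrite ?ne.
have hI : {in D &, injective h}.
  move=> [[d e] a] t tD t'D eh; have := tD; rewrite inE /=.
  move=> /andP[/andP[/eqP fd /eqP fe] /eqP fa].
  case: t t'D eh => [[d' e'] a'] t'D eh.
  have mem x : x \in h (d, e, a) -> x \in h (d', e', a') by rewrite eh.
  have [|/(_ fd)-> _ _] := hD d _ t'D; first by rewrite mem // !inE eqxx.
  have [|_ /(_ fe)-> _] := hD e _ t'D; first by rewrite mem // !inE eqxx orbT.
  by have [|_ _ /(_ fa)->] := hD a _ t'D; first by rewrite mem // !inE eqxx orbT.
transitivity (\sum_(t in D) hgt (h t)); last by apply: eq_bigl => t; rewrite inE.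
rewrite -(big_imset _ hI) /=; apply: eq_bigl => A.
apply/andP/imsetP => [[A3 /eqP fA] | [[[d e] a] tD ->]].
  have mem x : x \in [set l; k; i] -> exists2 d, d \in A & f d = x.
    by rewrite -fA => /imsetP[d dA ->]; exists d.
  have [|d dA fd] := mem l; first by rewrite !inE eqxx.
  have [|e eA fe] := mem k; first by rewrite !inE eqxx orbT.
  have [|a aA fa] := mem i; first by rewrite !inE eqxx orbT.
  exists (d, e, a); first by rewrite inE /= fd fe fa !eqxx.
  apply/esym/eqP; rewrite eqEcard /h /= (eqP A3) !subUset !sub1set dA eA aA /=.
  by rewrite (eqP (u3 _ _ _ fd fe fa)).
move: tD; rewrite inE /= => /andP[/andP[/eqP fd /eqP fe] /eqP fa].
by rewrite u3 // /h /= !imsetU !imset_set1 fd fe fa.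
Qed.

Lemma pull_star (l k : 'I_n) (X : {set 'I_n}) :
  l != k -> l \notin X -> k \notin X ->
  pull f (\sum_(b in X) hgt [set l; k; b]) =
  \sum_(d | f d == l) \sum_(e | f e == k)
    \sum_(a in f @^-1: X) hgt [set d; e; a].
Proof.
move=> lk lX kX; rewrite linear_sum /=.
transitivity (\sum_(b in X) \sum_(d | f d == l) \sum_(e | f e == k)
  \sum_(a | f a == b) hgt [set d; e; a]).
  apply: eq_bigr => b bX; apply: pull_hgt3; rewrite /= !inE negb_or lk andbT /=.
  by apply/andP; split; [apply: contraNneq lX | apply: contraNneq kX] => ->.
rewrite exchange_big; apply: eq_bigr => d _.
rewrite exchange_big; apply: eq_bigr => e _.
rewrite [RHS](partition_big f (mem X)) => [|a]; last by rewrite inE.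
apply: eq_bigr => b bX; apply: eq_bigl => a; rewrite inE.
by case: eqP => [-> | _]; rewrite ?bX ?andbF.
Qed.

(** The pullback of a five-term relation is a sum over [B] above [A], [d] above
    [l] and [e] above [k] of stars with the sum extended to the preimage of [A],
    which contains [B]. *)
Lemma pull_qd_hom : qd_hom (EHKR n) (EHKR m) (pull f).
Proof.
apply/qd_homP; apply: ehkr_rel_sub => [I J I3 J3 dIJ | A l k A3 lA kA lk].
  rewrite -memv_preim tens2_map_wedge !pull_hgt //.
  apply: memv_wedge_suml => A /andP[_ /eqP fA].
  apply: memv_wedge_sumr => B /andP[_ /eqP fB].
  apply: wedge_disjoint; apply/pred0P=> x /=; apply/negP=> /andP[xA xB].
  by have /pred0P/(_ (f x))/negP[] := dIJ; rewrite /= -fA -fB !imset_f.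
rewrite -memv_preim tens2_map_wedge pull_star // pull_hgt //.
apply: memv_wedge_suml => B /andP[_ /eqP fB].
apply: memv_wedge_sumr => d /eqP fd; apply: memv_wedge_sumr => e /eqP fe.
apply: wedge_star.
- by rewrite -sub_imset_pre fB.
- by apply: contra lA => dB; rewrite -fB -fd imset_f.
- by apply: contra kA => eB; rewrite -fB -fe imset_f.
Qed.

End PullRel.

Lemma push_star n m (g : 'I_m -> 'I_n) (A : {set 'I_m}) (l k : 'I_m) :
  injective g ->
  push g (\sum_(a in A) hgt [set l; k; a]) =
  \sum_(b in g @: A) hgt [set g l; g k; b].
Proof.
move=> gI; rewrite linear_sum big_imset /=; last by move=> x y _ _ /gI.
by apply: eq_bigr => a _; rewrite push_hgt // !imsetU !imset_set1.
Qed.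

Lemma push_qd_hom n m (g : 'I_m -> 'I_n) :
  injective g -> qd_hom (EHKR m) (EHKR n) (push g).
Proof.
move=> gI; apply/qd_homP; apply: ehkr_rel_sub => [I J _ _ dIJ | A l k A3 lA kA lk].
  rewrite -memv_preim tens2_map_wedge !push_hgt // wedge_disjoint //.
  by rewrite imset_disjoint.
rewrite -memv_preim tens2_map_wedge push_star // push_hgt // wedge_star //.
  by rewrite mem_imset.
by rewrite mem_imset.
Qed.

Section CompRel.
Variables (n m k : nat) (e : k.+1 = (n + m)%N) (p : 'I_n).

Lemma collapse_eqP x : (collapse e p x == p) = (x \in inner e p @: [set: 'I_m]).
Proof.
apply/eqP/imsetP => [/(congr1 val) /= exp | [j _ ->]]; last first.
  apply: val_inj => /=; have := collapse_natP m p (p + j).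
  by have := ltn_ord j; lia.
have xm : (x - p < m)%N by have := collapse_natP m p x; lia.
exists (Ordinal xm); rewrite ?inE //; apply: val_inj => /=.
by have := collapse_natP m p x; lia.
Qed.

(** If the outer triple [I] contains [p], the fibre of [p] is the block, and the
    inner triple is contained in it; otherwise the two supports are disjoint. *)
Lemma wedge_pull_push (u : hgV n) (v : hgV m) :
  wedge (pull (collapse e p) u) (push (inner e p) v) \in EHKR k.
Proof.
rewrite (hgt_expand u) (hgt_expand v) [pull _ _]linear_sum [push _ _]linear_sum.
apply: memv_wedge_suml => I _; apply: memv_wedge_sumr => J _.
rewrite /= [pull _ _]linearZ [push _ _]linearZ memv_wedgeZ // memv_wedgeC /=.
rewrite push_hgt; last exact: inner_inj.
have dJ (x : 'I_k) : collapse e p x != p -> x \notin inner e p @: val J.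
  rewrite collapse_eqP; apply: contra => /imsetP[j _ ->].
  by rewrite imset_f ?inE.
have [pI | pI] := boolP (p \in val I).
  have [l [i [li lp ip ->]]] := cards3_memP (valP I) pI.
  rewrite pull_hgt3; last by rewrite /= !inE negb_or li lp ip.
  apply: memv_wedge_sumr => c /eqP fc; apply: memv_wedge_sumr => d /eqP fd.
  rewrite (eq_bigl (mem (inner e p @: setT))) => [|a]; last exact: collapse_eqP.
  by apply: wedge_star; rewrite ?imsetS ?subsetT ?dJ ?fc ?fd.
rewrite pull_hgt; last exact: valP I.
apply: memv_wedge_sumr => A /andP[_ /eqP fA].
apply: wedge_disjoint; rewrite disjoint_sym; apply/pred0P=> x /=.
apply/negP=> /andP[xA]; apply/negP/dJ; apply: contraNneq pI => <-.
by have := imset_f (collapse e p) xA; rewrite fA.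
Qed.

Lemma comp_qd_hom : qd_hom (oplus (EHKR n) (EHKR m)) (EHKR k) (hg_comp e p).
Proof.
apply: qd_hom_oplus => [||u v].
- rewrite (_ : (_ \o _)%VF = pull (collapse e p)); first exact: pull_qd_hom.
  by apply/lfunP=> u; rewrite lfunE /= inl_homE hg_comp_pull_push linear0 addr0.
- rewrite (_ : (_ \o _)%VF = push (inner e p)).
    exact: push_qd_hom (@inner_inj _ _ _ _ _).
  by apply/lfunP=> v; rewrite lfunE /= inr_homE hg_comp_pull_push linear0 add0r.
rewrite !hg_comp_pull_push !linear0 addr0 add0r; exact: wedge_pull_push.
Qed.

End CompRel.

Lemma ehkr_operad : qd_operad EHKR hg_act hg_comp.
Proof.
split.
- by move=> n s; rewrite hg_act_push; apply: push_qd_hom; apply: perm_inj.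
- exact: comp_qd_hom.
- exact: hg_act1.
- exact: hg_actM.
- exact: hg_unitr.
- exact: hg_unitl.
- exact: hg_seq.
- exact: hg_par.
- exact: hg_equiv.
Qed.

(** * Minimality *)

Section Minimal.
Variable Q : forall n, qdata (hgV n).
Hypothesis opQ : qd_operad Q hg_act hg_comp.

(** The relations [[V, W]_-] of the monoidal product force these wedges. *)
Lemma operad_wedge n m k (e : k.+1 = (n + m)%N) (p : 'I_n) u v :
  wedge (pull (collapse e p) u) (push (inner e p) v) \in Q k.
Proof.
have : tens2_map (hg_comp e p) (wedge (u, 0) (0, v)) \in Q k.
  apply: (subvP (qop_comp_hom opQ e p)); rewrite memv_img //= -inl_homE -inr_homE.
  by apply: (subvP (addvSl _ _)); apply: (subvP (addvSr _ _)); exact: mem_qd_comm.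
by rewrite tens2_map_wedge !hg_comp_pull_push !linear0 addr0 add0r.
Qed.

Lemma operad_wedge_act n (s : 'S_n) (x y : hgV n) :
  wedge x y \in Q n -> wedge (push s x) (push s y) \in Q n.
Proof.
move=> xyQ; rewrite -hg_act_push -tens2_map_wedge.
by apply: (subvP (qop_act_hom opQ s)); rewrite memv_img.
Qed.

(** Here [P] is the block of a composite at the first label of an outer
    operation of arity [n - 2] with an inner one of arity 3.  Its only triple is
    [P], and off [P] the collapse is injective.  Outer triples that avoid the
    first label then pull back to triples disjoint from [P], and the others to
    stars on [P]. *)
Lemma operad_block_rel n : (3 <= n)%N ->
  exists P : {set 'I_n}, [/\ #|P| == 3%N,
    forall J : {set 'I_n}, #|J| == 3%N -> [disjoint P & J] ->
      wedge (hgt P) (hgt J) \in Q n &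
    forall l m, l \notin P -> m \notin P -> l != m ->
      wedge (hgt P) (\sum_(a in P) hgt [set l; m; a]) \in Q n].
Proof.
move=> n3; have e : n.+1 = ((n - 2) + 3)%N by lia.
have p0 : (0 < n - 2)%N by lia.
pose p := Ordinal p0; pose f := collapse e p; pose P := f @^-1: [set p].
have eP : P = inner e p @: setT.
  by apply/setP=> x; rewrite !inE -collapse_eqP.
have P3 : #|P| == 3%N.
  by rewrite eP card_imset ?cardsT ?card_ord //; apply: inner_inj.
have fI x y : x \notin P -> f x = f y -> x = y.
  rewrite !inE => xP /(congr1 val) /= exy; apply: val_inj.
  move: xP; rewrite -val_eqE /=.
  by have := collapse_natP 3 0 x; have := collapse_natP 3 0 y; lia.
have hP u : wedge (hgt P) (pull f u) \in Q n.
  have T3 : #|[set: 'I_3]| == 3%N by rewrite cardsT card_ord.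
  have := operad_wedge e p u (hgt setT).
  by rewrite push_hgt -?eP 1?memv_wedgeC //; apply: inner_inj.
exists P; split=> // [J J3 dPJ | l m lP mP lm].
  have JP x : x \in J -> x \notin P.
    move=> xJ; apply/negP=> xP; have /pred0P/(_ x)/negP[] := dPJ.
    by rewrite /= xP xJ.
  suff <- : pull f (hgt (f @: J)) = hgt J by apply: hP.
  have fJ3 : #|f @: J| == 3%N.
    by rewrite card_in_imset // => x y xJ _; apply: fI; apply: JP.
  rewrite pull_hgt // (bigD1 J) ?J3 ?eqxx //= big1 ?addr0 //.
  move=> A /andP[/andP[A3 /eqP fA] /eqP[]]; apply/eqP.
  rewrite eqEcard (eqP A3) (eqP J3) leqnn andbT; apply/subsetP=> x xA.
  have : f x \in f @: J by rewrite -fA imset_f.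
  by case/imsetP=> y yJ /esym/fI <-//; apply: JP.
have fE x y : x \notin P -> (f y == f x) = (y == x).
  move=> xP; apply/eqP/eqP => [/esym/fI->|->] //.
have := hP (\sum_(b in [set p]) hgt [set f l; f m; b]).
rewrite pull_star; first last.
- by move: mP; rewrite !inE.
- by move: lP; rewrite !inE.
- by rewrite eq_sym fE // eq_sym.
rewrite (big_pred1 l) => [|d]; last exact: fE.
by rewrite (big_pred1 m) => [|d]; last exact: fE.
Qed.

Lemma ehkr_sub_operad n : (EHKR n <= Q n)%VS.
Proof.
have [n3 | n3] := leqP 3 n; last first.
  apply: ehkr_rel_sub => [I J I3 | A l m A3].
    by have := max_card (mem I); rewrite (eqP I3) card_ord leqNgt n3.
  by have := max_card (mem A); rewrite (eqP A3) card_ord leqNgt n3.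
have [P [P3 dP sP]] := operad_block_rel n3.
have mv (A : {set 'I_n}) : #|A| == 3%N -> exists s : 'S_n, s @: P = A.
  by move=> /eqP A3; apply: perm_imset_card; rewrite (eqP P3).
apply: ehkr_rel_sub => [I J /mv[s <-] | A l m /mv[s <-]].
  have -> : J = s @: (s^-1%g @: J).
    by rewrite -imset_comp -[LHS]imset_id; apply: eq_imset => x /=; rewrite permKV.
  move: (s^-1%g @: J) => {}J; rewrite card_imset => [J3|]; last exact: perm_inj.
  rewrite imset_disjoint => [dPJ|]; last exact: perm_inj.
  rewrite -!(push_hgt _ (@perm_inj _ s)); apply: operad_wedge_act; exact: dP.
rewrite -(permKV s l) -(permKV s m) (inj_eq perm_inj) !(mem_imset _ _ perm_inj).
move=> lP mP lm; rewrite -(push_star _ _ _ perm_inj) -(push_hgt _ perm_inj).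
apply: operad_wedge_act; exact: sP.
Qed.

End Minimal.

Theorem theorem5p3 : smallest_qd_suboperad hg_act hg_comp HG EHKR.
Proof.
split; last by move=> Q [_ opQ] n; apply: ehkr_sub_operad.
split; last exact: ehkr_operad.
by move=> n; apply: ehkr_rel_wedge.
Qed.
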